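(* $\theta^{\rm U}(2,2)>0$ and $\theta^{\rm U}(3,3)>0$.
   Context: For integers $d\ge1$ and $1\le k\le 2d$, let each vertex $x\in\mathbb{Z}^d$, independently of all others, choose a uniformly random subset of exactly $k$ of its $2d$ nearest neighbors (in $\ell_1$-distance). The undirected $k$-neighbor graph ($k$-UnG) on $\mathbb{Z}^d$ has an undirected edge between nearest neighbors $x,y$ whenever $x$ chose $y$ or $y$ chose $x$ (or both). We write $\theta^{\rm U}(k,d)=\mathbb{P}(o\rightsquigarrow\infty\text{ in the $k$-UnG on }\mathbb{Z}^d)$, where $o$ is the origin and $o\rightsquigarrow\infty$ is the event that there is an infinite self-avoiding path of edges of the $k$-UnG starting at $o$. *)

(* Defs.v *)
From HB Require Import structures.
From mathcomp Require Import all_boot all_order all_algebra.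
From mathcomp Require Import all_classical all_reals all_analysis.
Set Implicit Arguments. Unset Strict Implicit. Unset Printing Implicit Defensive.
Import Order.TTheory GRing.Theory Num.Theory.
Local Open Scope classical_set_scope.
Local Open Scope ring_scope.

Definition vtx (d : nat) := {ffun 'I_d -> int}.

Definition origin (d : nat) : vtx d := [ffun => 0%R].

(* The 2d nearest-neighbour directions: (i, true) = +e_i, (i, false) = -e_i. *)
Definition dir (d : nat) := ('I_d * bool)%type.

Definition shift (d : nat) (x : vtx d) (u : dir d) : vtx d :=
  [ffun j => if j == u.1 then x j + (if u.2 then 1 else -1) else x j].

Definition opp_dir (d : nat) (u : dir d) : dir d := (u.1, ~~ u.2).

(* A configuration: every vertex has chosen a set of directions
   (the chosen neighbours are the shifts of x in those directions). *)
Definition config (d : nat) := vtx d -> {set dir d}.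

Definition ung_edge (d : nat) (c : config d) (x y : vtx d) : Prop :=
  exists u : dir d, y = shift x u /\ (u \in c x \/ opp_dir u \in c y).

Definition percolates (d : nat) (c : config d) : Prop :=
  exists p : nat -> vtx d,
    [/\ p 0%N = origin d, injective p & forall n, ung_edge c (p n) (p n.+1)].

Definition unif_k_prob (R : realType) (d k : nat) (S : {set dir d}) : R :=
  (#|S| == k)%:R / ('C(2 * d, k))%:R.

(* X : vtx d -> T -> {set dir d} is a family of random choices on the
   probability space (T, P) realising the k-neighbour model: each X x is a
   (measurable) random variable, and the X x are independent, each uniform on
   the k-subsets of the 2d directions (i.e. all finite-dimensional
   distributions are the product of the uniform laws). *)
Definition kneighbor_model (R : realType) (dsp : measure_display)
  (T : measurableType dsp) (P : probability T R) (d k : nat)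
  (X : vtx d -> T -> {set dir d}) : Prop :=
  (forall x S, measurable (X x @^-1` [set S])) /\
  (forall (s : seq (vtx d)) (F : vtx d -> {set dir d}), uniq s ->
     P [set w | forall x, x \in s -> X x w = F x] =
     (\prod_(x <- s) unif_k_prob R k (F x))%:E).

Definition perc_event (T : Type) (d : nat) (X : vtx d -> T -> {set dir d})
  : set T := [set w | percolates (fun x => X x w)].

Definition thetaU_pos (d k : nat) : Prop :=
  forall (R : realType) (dsp : measure_display) (T : measurableType dsp)
    (P : probability T R) (X : vtx d -> T -> {set dir d}),
    kneighbor_model P k X ->
    measurable (perc_event X) /\ (0 < P (perc_event X))%E.

(* Main.v *)
Require Import Defs.
From mathcomp Require Import all_boot all_order all_algebra.
From mathcomp Require Import all_classical all_reals all_analysis.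
From mathcomp Require Import zify ring lra.

(* Peierls argument in a coordinate plane of Z^d. When k = d every edge is
   closed with probability 1/4, and n given edges are simultaneously closed with
   probability at most 4^-n. If the open cluster C of the origin in the plane is
   finite, let (j, 0) be its last point on the positive half-axis and follow the
   boundary of C from the side between (j, 0) and (j + 1, 0). The boundary step
   is injective, so the walk is periodic, and by a discrete Stokes argument the
   signed number of its crossings of the horizontal ray to the right of a point
   is constant on C; this number is positive at (j, 0), but would vanish at the
   origin if the walk stayed to the right of the origin. Hence the walk gets to
   the left of the origin, and its first j + 2 sides are distinct and closed.
   There are 3^(j+1) such walks, and the sum over j of 3^(j+1) / 4^(j+2) is
   3/4 < 1. *)

Set Implicit Arguments. Unset Strict Implicit.
Unset Printing Implicit Defensive.
Import Order.TTheory GRing.Theory Num.Theory.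
Local Open Scope classical_set_scope.
Local Open Scope ring_scope.

(** * König's lemma for self-avoiding paths in a locally finite graph *)

Section SelfAvoiding.
Variables (T : eqType) (e : rel T) (nb : T -> seq T).
Hypothesis e_nb : forall x y, e x y -> y \in nb x.

Definition saw x p := path e x p && uniq (x :: p).

Definition ray x := exists f : nat -> T,
  [/\ f 0%N = x, injective f & forall n, e (f n) (f n.+1)].

Lemma saw_catl x p q : saw x (p ++ q) -> saw x p.
Proof.
rewrite /saw cat_path -cat_cons cat_uniq => /andP[/andP[-> _]].
by case/andP.
Qed.

Lemma ray_saw x n : ray x -> exists2 p, size p = n & saw x p.
Proof.
case=> f [f0 injf ef]; exists [seq f i | i <- iota 1 n].
  by rewrite size_map size_iota.
rewrite /saw -{2}f0 -(map_cons f) (_ : 0%N :: iota 1 n = iota 0 n.+1) //.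
rewrite (map_inj_uniq injf) iota_uniq andbT -f0.
by elim: n 0%N => //= n IH k; rewrite ef IH.
Qed.

Definition extendable x p := forall n, exists2 q, size q = n & saw x (p ++ q).

(** Otherwise each neighbor [y] of the last vertex comes with a length [g y] that continuations
    through [y] cannot reach, and the maximum over the finite list [nb] bounds all continuations of
    [p]. *)
Lemma extendable_rcons x p :
  extendable x p -> exists y, extendable x (rcons p y).
Proof.
move=> extp; apply: contrapT => /forallNP nex.
have {nex} /choice[g gP] : forall y, exists n,
    ~ exists2 q, size q = n & saw x (rcons p y ++ q).
  by move=> y; apply/existsNP/nex.
pose N := \max_(y <- nb (last x p)) g y.
have [[|y q] //= [szq] sawq] := extp N.+1.
have ynb : y \in nb (last x p).
  by apply: e_nb; move: sawq; rewrite /saw cat_path /= => /andP[/and3P[]].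
have leN : (g y <= size q)%N by rewrite szq; apply: leq_bigmax_seq.
apply: (gP y); exists (take (g y) q); first by rewrite size_takel.
by apply: (@saw_catl _ _ (drop (g y) q)); rewrite -catA cat_take_drop cat_rcons.
Qed.

Lemma konig x : (forall n, exists2 p, size p = n & saw x p) -> ray x.
Proof.
move=> long.
have /choice[g gP] : forall p, exists y,
    extendable x p -> extendable x (rcons p y).
  move=> p; have [/extendable_rcons[y yP]|np] := pselect (extendable x p).
    by exists y.
  by exists x.
pose P n := iter n (fun p => rcons p (g p)) [::].
have extP n : extendable x (P n) by elim: n => //= n /gP.
have szP n : size (P n) = n by elim: n => //= n IH; rewrite size_rcons IH.
have sawP n : saw x (P n).
  by have [q _ /saw_catl] := extP n 0%N.
pose f n := last x (P n).
(* The paths [P n] are nested, so two values of [f] can be compared inside one self-avoiding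
   path. *)
have fE m n : (n <= m)%N -> nth x (x :: P m) n = f n.
  elim: m => [|m IH]; first by rewrite leqn0 => /eqP->.
  rewrite leq_eqVlt => /predU1P[->|].
    by rewrite /f (last_nth x) szP.
  by rewrite ltnS => lenm; rewrite /= -rcons_cons nth_rcons /= szP ltnS lenm IH.
exists f; split=> // [m n|n].
  move=> fmn; pose k := maxn m n.
  have /andP[_ uk] := sawP k.
  apply/eqP; rewrite -(nth_uniq x _ _ uk) /= ?szP ?ltnS ?leq_maxl ?leq_maxr //.
  by rewrite !fE ?leq_maxl ?leq_maxr // fmn.
have /andP[+ _] := sawP n.+1.
by rewrite /= rcons_path => /andP[_]; rewrite {2}/f /= last_rcons.
Qed.

(** By König's lemma some length [n] is not attained by self-avoiding paths. Every path shortens to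
    a self-avoiding one with the same end, so all ends lie in the finite ball of radius [n]. *)
Lemma finite_reach x : ~ ray x ->
  exists s : seq T, forall p, path e x p -> last x p \in s.
Proof.
move=> noray.
have [n nP] : exists n, ~ exists2 p, size p = n & saw x p.
  by apply/existsNP => long; apply/noray/konig.
pose ball k := iter k (fun s => s ++ flatten [seq nb y | y <- s]) [:: x].
have sub k m : (k <= m)%N -> {subset ball k <= ball m}.
  move=> /subnK <-; elim: (m - k)%N => //= i IH y /IH.
  by rewrite mem_cat => ->.
have ballP p : path e x p -> last x p \in ball (size p).
  elim/last_ind: p => [|p y IH]; first by rewrite /= mem_seq1.
  rewrite rcons_path last_rcons size_rcons => /andP[/IH mem exy] /=.
  rewrite mem_cat; apply/orP; right; apply/flattenP.
  by exists (nb (last x p)); [exact: map_f | exact: e_nb].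
exists (ball n) => p /shortenP[q pq uq _].
have ltq : (size q < n)%N.
  rewrite ltnNge; apply/negP => leq; apply: nP.
  exists (take n q); first by rewrite size_takel.
  by apply: (@saw_catl _ _ (drop n q)); rewrite cat_take_drop /saw pq.
exact: sub (ltnW ltq) _ (ballP _ pq).
Qed.

End SelfAvoiding.

(** * Boundary walks in the square lattice *)

Definition z2 := (int * int)%type.
(* [(axis, sign)], axis [false] being horizontal, sign [true] positive. *)
Definition pdir := (bool * bool)%type.
(* [(x, u)] stands for the edge from [x] to [move x u], or for its dual edge
   oriented so that [x] lies on the left. *)
Definition dside := (z2 * pdir)%type.

Definition move (x : z2) (u : pdir) : z2 :=
  let s := if u.2 then 1 else -1 in
  if u.1 then (x.1, x.2 + s) else (x.1 + s, x.2).

Definition rotl (u : pdir) : pdir := (~~ u.1, u.1 (+) u.2).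
Definition oppd (u : pdir) : pdir := (u.1, ~~ u.2).

Lemma moveK x u : move (move x u) (oppd u) = x.
Proof. by case: x u => [a b] [[] []]; rewrite /move /=; congr pair; lia. Qed.

Lemma moveC x u v : move (move x u) v = move (move x v) u.
Proof.
by case: x u v => [a b] [[] []] [[] []]; rewrite /move /=; congr pair; lia.
Qed.

Lemma moveCK x u v : move (move (move x u) v) (oppd u) = move x v.
Proof. by rewrite moveC moveK. Qed.

Lemma rotK u : oppd (rotl (rotl u)) = u. Proof. by case: u => [[] []]. Qed.
Lemma oppK u : oppd (oppd u) = u. Proof. by case: u => [[] []]. Qed.
Lemma rot_opp u : rotl (oppd u) = oppd (rotl u).
Proof. by case: u => [[] []]. Qed.

(* The three dual edges that continue a given one: left, straight, right. *)
Definition turn (e : dside) (t : 'I_3) : dside :=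
  let v := rotl e.2 in
  if t == 0 then (e.1, v) else
  if t == 1 then (move e.1 v, e.2) else (move (move e.1 e.2) v, oppd v).

(* The starting point of the dual edge, shifted by [(1/2, 1/2)]; its end point
   is the corner of [(e.1, rotl e.2)]. *)
Definition corner (e : dside) : z2 :=
  (e.1.1 + (e.2 \in [:: (false, true); (true, true)])%:Z,
   e.1.2 + (e.2 \in [:: (true, true); (false, false)])%:Z).

Lemma corner_turn e t : corner (turn e t) = corner (e.1, rotl e.2).
Proof.
rewrite /turn; case: e => [[a b] [[] []]];
  case: ifP => _ //=; case: ifP => _ //=;
  rewrite /corner /move /= ?inE /=; congr pair; lia.
Qed.

(* Signed crossing, by the dual edge [e], of the horizontal ray going right from
   [p]. *)
Definition ray_flux (p : z2) (e : dside) : int :=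
  if e.2.1 || (e.1.2 != p.2) then 0 else
  if e.2.2 then (p.1 <= e.1.1)%R%:Z else - (p.1 < e.1.1)%R%:Z.

(** The two rays differ only where they meet the dual edge between [p] and its right neighbor, whose
    two orientations are excluded. *)
Lemma ray_flux_right (p : z2) (e : dside) :
  e != (p, (false, true)) -> e != (move p (false, true), (false, false)) ->
  ray_flux (move p (false, true)) e = ray_flux p e.
Proof.
case: p e => [a b] [[c d] [[] []]] //;
  rewrite /ray_flux /move /= !xpair_eqE /= ?andbT ?andbF;
  repeat (case: ifP => ?); lia.
Qed.

(** Discrete Stokes: the corners between the two rays form a half-line, and the difference of fluxes
    records whether [e] enters or leaves it. Its left end can only be passed by the two excluded
    sides. Along a closed walk the right-hand side telescopes to 0. *)
Lemma ray_flux_up (p : z2) (e : dside) :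
  e != (p, (true, true)) -> e != (move p (true, true), (true, false)) ->
  ray_flux p e - ray_flux (move p (true, true)) e =
  ((p.1 < (corner (e.1, rotl e.2)).1) &&
   ((corner (e.1, rotl e.2)).2 == p.2 + 1))%R%:Z
  - ((p.1 < (corner e).1) && ((corner e).2 == p.2 + 1))%R%:Z.
Proof.
case: p e => [a b] [[c d] [[] []]] //;
  rewrite /ray_flux /move /corner /= !xpair_eqE /= ?inE /= ?andbT ?andbF;
  repeat (case: ifP => ?); lia.
Qed.

(** To the right of [p] the ray cuts the plane completely, so crossing it is the same as changing
    from below to above. *)
Lemma ray_flux_row (p : z2) (e : dside) : p.1 < (corner e).1 ->
  ray_flux p e =
  (p.2 < (corner (e.1, rotl e.2)).2)%R%:Z - (p.2 < (corner e).2)%R%:Z.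
Proof.
case: p e => [a b] [[c d] [[] []]] //;
  rewrite /ray_flux /corner /= ?inE /=; repeat (case: ifP => ?); lia.
Qed.
Section BoundaryWalk.
Variable C : pred z2.

Definition bd (e : dside) := C e.1 && ~~ C (move e.1 e.2).

(** The walk keeps [C] on its left. Where two vertices of [C] touch only diagonally, the first test
    makes it stay with the same vertex. *)
Definition bturn (e : dside) : 'I_3 :=
  if ~~ C (move e.1 (rotl e.2)) then 0 else
  if ~~ C (move (move e.1 e.2) (rotl e.2)) then 1 else 2.

Definition bnext e := turn e (bturn e).

Lemma nextE x u : bnext (x, u) =
  if ~~ C (move x (rotl u)) then (x, rotl u) else
  if ~~ C (move (move x u) (rotl u)) then (move x (rotl u), u) else
  (move (move x u) (rotl u), oppd (rotl u)).
Proof. by rewrite /bnext /turn /bturn; case: (C _) => //; case: (C _). Qed.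

(** The rule of [bnext] with left and right turns exchanged, which traces the boundary backwards. *)
Definition bprev (e : dside) : dside :=
  let w := oppd (rotl e.2) in
  if ~~ C (move e.1 w) then (e.1, w) else
  if ~~ C (move (move e.1 e.2) w) then (move e.1 w, e.2) else
  (move (move e.1 e.2) w, oppd w).

Lemma bd_next e : bd e -> bd (bnext e).
Proof.
case: e => x u /andP[/= Cx nCu]; rewrite nextE /bd.
case: ifPn => [nCv|/negPn Cv] /=; first by rewrite Cx nCv.
case: ifPn => [nCuv|/negPn Cuv] /=; first by rewrite Cv moveC nCuv.
by rewrite Cuv moveK.
Qed.

Lemma nextK : {in bd, cancel bnext bprev}.
Proof.
case=> x u /andP[/= Cx nCu]; rewrite nextE.
case: ifPn => [nCv|/negPn Cv] /=.
  by rewrite /bprev /= rotK nCu.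
case: ifPn => [nCuv|/negPn Cuv] /=; rewrite /bprev /=.
  by rewrite moveCK nCu moveK Cx.
rewrite rot_opp oppK.
have -> : rotl (rotl u) = oppd u by case: (u) => [[] []].
by rewrite moveCK !moveK Cv Cx oppK.
Qed.

Lemma bd_iter n e : bd e -> bd (iter n bnext e).
Proof. by elim: n => //= n IH /IH /bd_next. Qed.

Lemma iter_next_inj n e e' :
  bd e -> bd e' -> iter n bnext e = iter n bnext e' -> e = e'.
Proof.
move=> be be'; elim: n => //= n IH eq; apply: IH.
by rewrite -[LHS]nextK ?eq ?nextK //; apply: bd_iter.
Qed.

(** There are finitely many boundary sides, so two iterates coincide; injectivity of the boundary
    step cancels the common part and gives a return to [e] itself. *)
Lemma next_periodic (s : seq z2) e : {subset C <= s} -> bd e ->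
  exists2 n, (0 < n)%N & iter n bnext e = e.
Proof.
move=> Cs be; apply: contrapT => noper.
have inj : injective (fun n => iter n bnext e).
  move=> m n; wlog lemn : m n / (m <= n)%N => [H|].
    by case/orP: (leq_total m n) => /H // {}H /esym/H.
  rewrite -[in RHS](subnKC lemn) iterD.
  move=> /(iter_next_inj be (bd_iter _ be))/esym per.
  apply/eqP; rewrite eqn_leq lemn /=.
  rewrite leqNgt -subn_gt0; apply/negP => gt; apply: noper.
  by exists (n - m)%N.
pose L := [seq (x, u) | x <- s, u <- enum (pdir : finType)].
have sub : {subset [seq iter i bnext e | i <- iota 0 (size L).+1] <= L}.
  move=> _ /mapP[i _ ->]; have /andP[/Cs ins _] := bd_iter i be.
  case: (iter i bnext e) ins => x u ins.
  by apply/allpairsP; exists (x, u); rewrite ins mem_enum.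
have /uniq_leq_size/(_ sub) :
    uniq [seq iter i bnext e | i <- iota 0 (size L).+1].
  by rewrite (map_inj_uniq inj) iota_uniq.
by rewrite size_map size_iota ltnn.
Qed.

Lemma sum_corner (phi : z2 -> int) n e :
  \sum_(i < n) (phi (corner ((iter i bnext e).1, rotl (iter i bnext e).2))
                - phi (corner (iter i bnext e)))
  = phi (corner (iter n bnext e)) - phi (corner e).
Proof.
elim: n => [|n IH]; first by rewrite big_ord0 subrr.
by rewrite big_ord_recr IH /= /bnext corner_turn; lia.
Qed.

(* Connectedness of [C], in the only form that is used: a function that does not
   change along the edges inside [C] is constant on [C]. *)
Definition potential_connected := forall g : z2 -> int,
  (forall x u, C x -> C (move x u) -> g (move x u) = g x) ->
  forall x, C x -> g x = g (0, 0).

Variables (s : seq z2) (j : nat).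
Hypotheses (Cs : {subset C <= s}) (Cconn : potential_connected).
Hypotheses (C0 : C (0, 0)) (Cj : C (j%:Z, 0)).
Hypothesis Cmax : forall a : int, j%:Z < a -> ~~ C (a, 0).

Definition start : dside := ((j%:Z, 0), (false, true)).

Let W i := iter i bnext start.

Lemma bd_start : bd start.
Proof. by rewrite /bd Cj Cmax //= ltzD1. Qed.

Lemma walk_crosses : exists k, (corner (W k)).1 <= 0.
Proof.
apply: contrapT => /forallNP pos.
have {}pos i : 0 < (corner (W i)).1 by rewrite ltNge; apply/negP.
have [n n0 per] := next_periodic Cs bd_start.
pose F p := \sum_(i < n) ray_flux p (W i).
have bdW i : bd (W i) by apply/bd_iter/bd_start.
(* Neither orientation of an edge inside [C] is a boundary side, so the exclusions in the flux
   lemmas are met. *)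
have notW x u i : C x -> C (move x u) -> W i != (x, u).
  by move=> Cx Cu; apply: contraTneq (bdW i) => ->; rewrite /bd Cu andbF.
have notWN x u i : C x -> C (move x u) -> W i != (move x u, oppd u).
  by move=> Cx Cu; apply: notW => //; rewrite moveK.
have Fright x : C x -> C (move x (false, true)) ->
    F (move x (false, true)) = F x.
  move=> Cx Cu; apply: eq_bigr => i _.
  exact: ray_flux_right (notW _ _ _ Cx Cu) (notWN _ (false, true) _ Cx Cu).
have Fup x : C x -> C (move x (true, true)) -> F (move x (true, true)) = F x.
  move=> Cx Cu; apply/esym/eqP; rewrite -subr_eq0 -sumrB.
  have upE i := ray_flux_up (notW _ _ i Cx Cu) (notWN _ (true, true) i Cx Cu).
  under eq_bigr => i _ do rewrite upE.
  rewrite (sum_corner (fun c => ((x.1 < c.1) && (c.2 == x.2 + 1))%R%:Z)).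
  by rewrite per subrr.
have Fstep x u : C x -> C (move x u) -> F (move x u) = F x.
  case: u => [[] []] Cx Cu; [exact: Fup| |exact: Fright|].
    have -> : x = move (move x (true, false)) (true, true).
      by rewrite -{1}[x](moveK x (true, false)).
    by rewrite Fup ?moveK // (moveK x (true, false)).
  have -> : x = move (move x (false, false)) (false, true).
    by rewrite -{1}[x](moveK x (false, false)).
  by rewrite Fright ?moveK // (moveK x (false, false)).
(* The starting side contributes 1; a negative contribution would need a point of [C] on the axis
   beyond [(j, 0)]. *)
have Fj : 0 < F (j%:Z, 0).
  rewrite /F; case: n n0 {per F Fright Fup Fstep} => // n _.
  rewrite big_ord_recl ltr_wpDr //; last by rewrite /ray_flux /= lexx.
  apply: sumr_ge0 => i _; rewrite /ray_flux.
  have := bdW (lift ord0 i); case: (W _) => [[a b] [ax sg]] /=.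
  case: ifP => // /norP[_ /negPn/eqP->]; case: ifP => // _ /andP[Ca _].
  by case: ltP => // lt; have := Cmax lt; rewrite Ca.
(* All corners are assumed to lie right of the origin, so the flux there is a change of height,
   which telescopes over the period. *)
have : F (0, 0) = 0.
  have rowE i := @ray_flux_row (0, 0) (W i) (pos i).
  rewrite /F; under eq_bigr => i _ do rewrite rowE.
  by rewrite (sum_corner (fun c => (0 < c.2)%R%:Z)) per subrr.
by rewrite -(Cconn Fstep Cj) => F0; rewrite F0 ltxx in Fj.
Qed.

Lemma corner_next_le e : (corner e).1 <= (corner (bnext e)).1 + 1.
Proof.
rewrite /bnext corner_turn.
by case: e => [[a b] [[] []]]; rewrite /corner /= ?inE /=; lia.
Qed.

(** A repetition would trap the walk in its first sides for ever, but it must reach abscissa at most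
    0, and it moves left by at most 1 per step. *)
Lemma walk_uniq : uniq (traject bnext start j.+2).
Proof.
have ex : exists k, (corner (W k)).1 <= 0 by exact: walk_crosses.
case: (ex_minnP ex) => k k0 kmin.
(* The first side is vertical, hence costs no abscissa: this gives [j + 2] distinct sides rather
   than [j + 1]. *)
have c1 : (corner (W 1)).1 = j%:Z + 1.
  by rewrite -[W 1]/(bnext start) corner_turn /corner /= ?inE.
have ck i : j%:Z + 1 - i%:Z <= (corner (W i.+1)).1.
  elim: i => [|i IH]; first by rewrite c1; lia.
  by have := corner_next_le (W i.+1); rewrite -[bnext _]/(W i.+2); lia.
have ltk : (j.+1 < k)%N.
  case: k k0 {kmin} => [|k]; first by rewrite /corner /= ?inE /=; lia.
  by have := ck k; lia.
rewrite looping_uniq; apply/negP => /loopingP/(_ k)/trajectP[i lti eqk].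
have : (k <= i)%N by apply: kmin; rewrite /W -eqk.
lia.
Qed.

End BoundaryWalk.

(** Encoding by turns makes the candidate walks independent of [C], with 3^(j+1) of them from
    [start j]. *)
Fixpoint walk (e : dside) (t : seq 'I_3) : seq dside :=
  if t is a :: t' then e :: walk (turn e a) t' else [:: e].

Lemma size_walk e t : size (walk e t) = (size t).+1.
Proof. by elim: t e => //= a t IH e; rewrite IH. Qed.

Lemma walk_traject C e n :
  walk e [seq bturn C i | i <- traject (bnext C) e n] =
  traject (bnext C) e n.+1.
Proof. by elim: n e => //= n IH e; rewrite IH. Qed.

Lemma closed_walk_exists (C : pred z2) (s : seq z2) :
  {subset C <= s} -> potential_connected C -> C (0, 0) ->
  exists j (t : j.+1.-tuple 'I_3),
    uniq (walk (start j) t) /\ all (bd C) (walk (start j) t).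
Proof.
move=> Cs Cconn C0.
pose Q j := C (j%:Z, 0).
have exQ : exists j, Q j by exists 0%N.
have ubQ j : Q j -> (j <= \max_(x <- s) `|x.1|)%N.
  move=> /Cs ins.
  exact: (@leq_bigmax_seq _ s xpredT (fun x : z2 => `|x.1|%N) _ ins).
case: (ex_maxnP exQ ubQ) => j Cj jmax.
have Cmax (a : int) : j%:Z < a -> ~~ C (a, 0).
  case: a => [a|//]; rewrite ltz_nat => lt; apply/negP => /jmax.
  by rewrite leqNgt lt.
pose t := [seq bturn C i | i <- traject (bnext C) (start j) j.+1].
have szt : size t == j.+1 by rewrite size_map size_traject.
exists j, (Tuple szt); rewrite [tval _]/= walk_traject; split.
  exact: walk_uniq Cs Cconn C0 Cj Cmax.
by apply/allP => e /trajectP[i _ ->]; apply/bd_iter/bd_start.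
Qed.

(** * The probability that given edges are closed *)

(** The ratio of 'C(m + 1, d) to 'C(m, d) is (m + 1) / (m + 1 - d), which is at least 2 for d <= m <
    2d. *)
Lemma bin_half (d h : nat) : (0 < d)%N ->
  ('C(2 * d - h, d) * 2 ^ h <= 'C(2 * d, d))%N.
Proof.
move=> d0; have step m : (m.+1 <= 2 * d)%N -> (2 * 'C(m, d) <= 'C(m.+1, d))%N.
  move=> le; have [ltm|ged] := ltnP m d; first by rewrite bin_small.
  rewrite -(@leq_pmul2l (m.+1 - d)) ?subn_gt0 //.
  by rewrite -mul_bin_down /= mulnA leq_mul2r; apply/orP; right; lia.
elim: h => [|h IH]; first by rewrite subn0 muln1.
have [lt|ge] := ltnP h (2 * d)%N.
  apply: leq_trans IH; rewrite expnS mulnA leq_mul2r mulnC.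
  have -> : (2 * d - h = (2 * d - h.+1).+1)%N by lia.
  by rewrite step ?orbT //; lia.
(* Here the truncated subtraction is 0, and so is the binomial because [d] is positive. *)
have -> : (2 * d - h.+1 = 0)%N by lia.
by rewrite bin_small.
Qed.

Lemma card_dir d : #|{: dir d}| = (2 * d)%N.
Proof. by rewrite card_prod card_ord card_bool mulnC. Qed.

Lemma unif_avoid_le (R : realType) d (N : {set dir d}) : (0 < d)%N ->
  \sum_(S : {set dir d} | [disjoint S & N]) unif_k_prob R d S <= 2^-1 ^+ #|N|.
Proof.
move=> d0; rewrite -mulr_suml -natr_sum.
have -> : (\sum_(S : {set dir d} | [disjoint S & N]) (#|S| == d))%N
    = 'C(2 * d - #|N|, d).
  rewrite -card_dir -{2}[N]finset.setCK -cardsCs -cards_draws.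
  rewrite -sum1_card big_mkcond [RHS]big_mkcond; apply: eq_bigr => S _.
  rewrite inE finset.subsets_disjoint finset.setCK.
  by case: disjoint => //; case: eqP.
rewrite exprVn ler_pdivrMr ?ltr0n ?bin_gt0 ?leq_pmull //.
rewrite mulrC ler_pdivlMr ?exprn_gt0 ?ltr0n //.
by rewrite -natrX -natrM ler_nat bin_half.
Qed.

Section FiniteUnion.
Context {R : realType} {dsp : measure_display} {T : measurableType dsp}.
Variable P : probability T R.

Lemma measure_bigsetU_le (I : Type) (s : seq I) (Q : pred I) (A : I -> set T) :
  (forall i, measurable (A i)) ->
  (P (\big[setU/set0]_(i <- s | Q i) A i) <= \sum_(i <- s | Q i) P (A i))%E.
Proof.
move=> mA; elim: s => [|i s IH]; first by rewrite !big_nil measure0.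
rewrite !big_cons; case: ifP => // _.
apply: le_trans (measureU2 _ _ _) _ => //; last exact: leeD.
exact: bigsetU_measurable.
Qed.

End FiniteUnion.

Section Model.
Context {R : realType} {dsp : measure_display} {T : measurableType dsp}.
Variables (P : probability T R) (d k : nat) (X : vtx d -> T -> {set dir d}).
Hypothesis model : kneighbor_model P k X.

Lemma measurable_choice x (Q : pred {set dir d}) :
  measurable [set w | Q (X x w)].
Proof.
rewrite [X in measurable X](_ : _ =
    \bigcup_(S in [set` Q]) (X x @^-1` [set S])).
  rewrite bigcup_pred; apply: bigsetU_measurable => S _.
  exact: (proj1 model).
apply/seteqP; split=> w /= => [Qw|[S QS XS]]; last by rewrite XS.
by exists (X x w).
Qed.

Lemma measurable_choice2 x y (Q : rel {set dir d}) :
  measurable [set w | Q (X x w) (X y w)].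
Proof.
rewrite [X in measurable X](_ : _ =
    \bigcup_(S in [set` (predT : pred {set dir d})])
      ((X x @^-1` [set S]) `&` [set w | Q S (X y w)])).
  rewrite bigcup_pred; apply: bigsetU_measurable => S _.
  by apply: measurableI; [apply: (proj1 model) | apply: measurable_choice].
apply/seteqP; split=> w /= => [Qw|[S _ [-> //]]].
by exists (X x w).
Qed.

Lemma measurable_choices (s : seq (vtx d)) (Q : vtx d -> pred {set dir d}) :
  measurable [set w | all (fun x => Q x (X x w)) s].
Proof.
elim: s => [|x s IH] /=.
  by rewrite (_ : mkset _ = setT) //; apply/seteqP.
rewrite (_ : [set w | _] = [set w | Q x (X x w)] `&`
    [set w | all (fun x => Q x (X x w)) s]).
  by apply: measurableI => //; apply: measurable_choice.
by apply/seteqP; split=> w /= => [/andP|[-> ->]].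
Qed.

(** The model prescribes probabilities of exact values only. The induction therefore moves vertices
    one by one from [s1] to [s2], with a union bound over the value [S] taken at the moved
    vertex. *)
Lemma choices_prob_le (s1 s2 : seq (vtx d)) (Q : vtx d -> pred {set dir d}) F :
  uniq (s1 ++ s2) ->
  (P ([set w | all (fun x => Q x (X x w)) s1] `&`
      [set w | all (fun x => X x w == F x) s2]) <=
   ((\prod_(x <- s1) \sum_(S | Q x S) unif_k_prob R k S) *
    \prod_(x <- s2) unif_k_prob R k (F x))%:E)%E.
Proof.
elim: s1 s2 F => [|x s1 IH] s2 F us.
  rewrite big_nil mul1r -(proj2 model) // (_ : [set w | _] `&` _ =
    [set w | forall x, x \in s2 -> X x w = F x]) //.
  apply/seteqP; split=> w /= => [[_ /allP H] x /H/eqP //|H]; split=> //.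
  by apply/allP => x /H ->.
pose A S := [set w | all (fun x => Q x (X x w)) s1] `&`
  [set w | all (fun y => X y w == if y == x then S else F y) (x :: s2)].
have mA S : measurable (A S).
  apply: measurableI; first exact: measurable_choices.
  exact: (measurable_choices _ (fun y S' => S' == if y == x then S else F y)).
have xs2 : x \notin s2.
  by move: us => /= /andP[]; rewrite mem_cat => /norP[].
have FE S : {in s2, forall y, (if y == x then S else F y) = F y}.
  by move=> y ys2; case: eqP => // yx; rewrite -yx ys2 in xs2.
apply: (@le_trans _ _ (P (\bigcup_(S in [set` Q x]) A S))).
  apply: le_measure; rewrite ?inE.
  - apply: measurableI; first exact: measurable_choices.
    exact: (measurable_choices _ (fun y S' => S' == F y)).
  - by rewrite bigcup_pred; apply: bigsetU_measurable.
  move=> w /= [/andP[Qx Qs1] Fs2]; exists (X x w) => //; split=> //=.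
  rewrite eqxx eqxx /=; apply/allP => y ys2; rewrite FE //.
  exact: (allP Fs2).
rewrite bigcup_pred big_cons; apply: le_trans (measure_bigsetU_le _ _ _ mA) _.
have {}IH S : (P (A S) <= (
    (\prod_(x <- s1) \sum_(S | Q x S) unif_k_prob R k S) *
    (unif_k_prob R k S * \prod_(x <- s2) unif_k_prob R k (F x)))%:E)%E.
  apply: le_trans (IH (x :: s2) _ _) _.
    by rewrite -cat_rcons -cats1 -catA uniq_catCA in us *.
  rewrite big_cons eqxx lee_fin (_ : \prod_(y <- s2) _ =
    \prod_(y <- s2) unif_k_prob R k (F y)) //.
  by apply: eq_big_seq => y /FE ->.
apply: le_trans (lee_sum _ (fun S _ => IH S)) _.
by rewrite sumEFin lee_fin -mulr_sumr -mulr_suml mulrCA mulrA.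
Qed.

End Model.

Section BalancedModel.
Context {R : realType} {dsp : measure_display} {T : measurableType dsp}.
Variables (P : probability T R) (d : nat) (X : vtx d -> T -> {set dir d}).
Hypotheses (model : kneighbor_model P d X) (d0 : (0 < d)%N).

Definition unchosen (H : seq (vtx d * dir d)) : set T :=
  [set w | all (fun h => h.2 \notin X h.1 w) H].

Definition dirs_at (H : seq (vtx d * dir d)) (x : vtx d) : {set dir d} :=
  [set u in [seq h.2 | h <- H & h.1 == x]]%SET.

(** Grouping the pairs by vertex gives the form to which independence applies. *)
Lemma unchosenE H : unchosen H =
  [set w | all (fun x => [disjoint X x w & dirs_at H x]%B) (undup (map fst H))].
Proof.
apply/seteqP; split=> w /= /allP av; apply/allP.
  move=> x _; rewrite disjoint_sym; apply/pred0Pn => -[u /andP[]].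
  rewrite /= inE => /mapP[h]; rewrite mem_filter => /andP[/eqP<- /av].
  by move=> + -> uX; rewrite uX.
move=> [x u] hH /=; have xs : x \in undup (map fst H).
  by rewrite mem_undup; apply/mapP; exists (x, u).
have := av x xs; rewrite disjoint_sym => /disjointFr -> //.
by rewrite inE; apply/mapP; exists (x, u) => //; rewrite mem_filter /= eqxx.
Qed.

Lemma measurable_unchosen H : measurable (unchosen H).
Proof.
rewrite unchosenE.
exact: (measurable_choices model _ (fun x S => [disjoint S & dirs_at H x]%B)).
Qed.

Lemma sum_dirs_at H : uniq H ->
  (\sum_(x <- undup (map fst H)) #|dirs_at H x|)%N = size H.
Proof.
move=> uH; have cardE x : #|dirs_at H x| = (\sum_(h <- H) (h.1 == x))%N.
  rewrite cardsE (card_uniqP _).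
    by rewrite size_map size_filter -sum1_count big_mkcond.
  rewrite map_inj_in_uniq ?filter_uniq // => -[x1 u1] [x2 u2].
  by rewrite !mem_filter /= => /andP[/eqP-> _] /andP[/eqP-> _] ->.
under eq_bigr => x _ do rewrite cardE.
rewrite exchange_big /= -sum1_size; apply: eq_big_seq => h hH.
rewrite (eq_bigr (fun x => if x == h.1 then 1 else 0)%N); last first.
  by move=> x _; rewrite eq_sym; case: eqP.
rewrite -big_mkcond sum1_count count_uniq_mem ?undup_uniq // mem_undup.
by rewrite map_f.
Qed.

(* Choosing exactly half of the directions makes every single direction unchosen
   with probability 1/2, and choices at one vertex are negatively correlated. *)
Lemma unchosen_prob_le H : uniq H -> (P (unchosen H) <= (2^-1 ^+ size H)%:E)%E.
Proof.
move=> uH; pose s := undup (map fst H).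
have us : uniq (s ++ [::]) by rewrite cats0 undup_uniq.
have := @choices_prob_le _ _ _ P d d X model s [::]
  (fun x S => [disjoint S & dirs_at H x]%B) (fun _ => finset.set0) us.
rewrite [X in _ `&` X](_ : _ = setT); last by apply/seteqP.
rewrite setIT unchosenE => /le_trans; apply.
rewrite big_nil mulr1 lee_fin -(sum_dirs_at uH) -/s.
rewrite -prodrXr.
apply: ler_prod => x _; rewrite unif_avoid_le // andbT.
by apply: sumr_ge0 => S _; rewrite /unif_k_prob divr_ge0.
Qed.

End BalancedModel.

(** * Percolation *)

Definition edge d (c : config d) : rel (vtx d) := fun x y =>
  [exists u : dir d,
    (y == Defs.shift x u) && ((u \in c x) || (opp_dir u \in c y))].

Lemma edgeP d (c : config d) x y : reflect (ung_edge c x y) (edge c x y).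
Proof.
apply: (iffP existsP) => [[u /andP[/eqP-> /orP h]]|[u [-> /orP h]]];
  exists u => //.
by rewrite eqxx.
Qed.

Lemma edge_shift d (c : config d) x y : edge c x y ->
  y \in [seq Defs.shift x u | u <- enum {: dir d}].
Proof. by case/existsP => u /andP[/eqP-> _]; apply: map_f; rewrite mem_enum. Qed.

Lemma percolates_saw d (c : config d) : percolates c <->
  forall n, exists2 p, size p = n & saw (edge c) (origin d) p.
Proof.
split=> [[f [f0 fi fe]] n|/(konig (@edge_shift d c))[f [f0 fi fe]]].
  by apply: ray_saw; exists f; split=> // m; apply/edgeP.
by exists f; split=> // m; apply/edgeP.
Qed.

(** * Measurability of the percolation event *)

Section MeasurablePercolation.
Context {R : realType} {dsp : measure_display} {T : measurableType dsp}.
Variables (P : probability T R) (d k : nat) (X : vtx d -> T -> {set dir d}).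
Hypothesis model : kneighbor_model P k X.

Lemma measurable_path x p : measurable [set w | path (edge (X^~ w)) x p].
Proof.
elim: p x => [|y p IH] x /=.
  by rewrite (_ : mkset _ = setT) //; apply/seteqP.
rewrite (_ : mkset _ = [set w | edge (X^~ w) x y] `&`
    [set w | path (edge (X^~ w)) y p]).
  apply: measurableI => //; exact: (measurable_choice2 model x y (fun S S' =>
    [exists u : dir d,
      (y == Defs.shift x u) && ((u \in S) || (opp_dir u \in S'))])).
by apply/seteqP; split=> w /= => [/andP|[-> ->]].
Qed.

(** König's lemma replaces the uncountable choice of an infinite path by finite paths of every
    length, of which there are countably many. *)
Lemma measurable_perc : measurable (perc_event X).
Proof.
rewrite (_ : perc_event X = \bigcap_n \bigcup_(p in [set: seq (vtx d)])
    ([set w | path (edge (X^~ w)) (origin d) p] `&`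
     [set w | size p = n /\ uniq (origin d :: p)])).
  apply: bigcapT_measurable => n; apply: countable_bigcupT_measurable.
    exact: countableP.
  move=> p; apply: measurableI; first exact: measurable_path.
  (* This condition does not involve [w], so the set is everything or empty. *)
  have [h|nh] := pselect (size p = n /\ uniq (origin d :: p)).
    by rewrite (_ : mkset _ = setT) //; apply/seteqP; split.
  by rewrite (_ : mkset _ = set0) //; apply/seteqP; split.
apply/seteqP; split=> w.
  move=> /percolates_saw H n _; have [p szp /andP[pp up]] := H n.
  by exists p.
move=> H; apply/percolates_saw => n.
by have [p _ [pp [szp up]]] := H n I; exists p => //; apply/andP.
Qed.

End MeasurablePercolation.

(** * The cluster of the origin in a coordinate plane *)

Section Plane.
Variable d : nat.

Definition emb (z : z2) : vtx d.+2 :=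
  [ffun i : 'I_d.+2 => if i == 0 then z.1 else if i == 1 then z.2 else 0].

Definition emb_dir (u : pdir) : dir d.+2 := (if u.1 then 1 else 0, u.2).

Lemma emb_inj : injective emb.
Proof.
move=> [a b] [a' b'] /ffunP eq; have := eq 0; have := eq 1.
by rewrite !ffunE /= => -> ->.
Qed.

Lemma emb_dir_inj : injective emb_dir.
Proof. by move=> [[] s] [[] s'] [] //= ->. Qed.

Lemma emb0 : emb (0, 0) = origin d.+2.
Proof. by apply/ffunP => i; rewrite !ffunE /=; do 2 case: ifP => //. Qed.

Lemma emb_move z u : emb (move z u) = Defs.shift (emb z) (emb_dir u).
Proof.
apply/ffunP => i; rewrite !ffunE; case: u => [[] s]; rewrite /move /emb_dir /=.
  have [->|_] := eqVneq i 0; first by rewrite eq_sym (negbTE (oner_neq0 _)).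
  by case: (i == 1).
by case: (i == 0).
Qed.

Lemma emb_opp u : emb_dir (oppd u) = opp_dir (emb_dir u).
Proof. by []. Qed.

(** An edge is closed when neither endpoint chooses the other, so every side yields two pairs. *)
Definition halves (es : seq dside) : seq (vtx d.+2 * dir d.+2) :=
  [seq (emb e.1, emb_dir e.2) | e <- es] ++
  [seq (emb (move e.1 e.2), emb_dir (oppd e.2)) | e <- es].

Lemma half_inj x u x' u' :
  (emb x, emb_dir u) = (emb x', emb_dir u') -> (x, u) = (x', u').
Proof.
move=> eq; have /emb_inj-> := congr1 fst eq.
by have /emb_dir_inj-> := congr1 snd eq.
Qed.

Lemma size_halves es : size (halves es) = (size es * 2)%N.
Proof. by rewrite size_cat !size_map muln2 addnn. Qed.

(** Pairs of the first kind sit at vertices in [C], those of the second kind at vertices outside. *)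
Lemma uniq_halves (C : pred z2) es :
  uniq es -> all (bd C) es -> uniq (halves es).
Proof.
move=> ues /allP bdes; rewrite cat_uniq !map_inj_uniq ?ues /= ?andbT.
- apply/hasPn => _ /mapP[e /bdes /andP[_ nC] ->].
  apply/mapP => -[e' /bdes /andP[C' _]] /half_inj[eq _].
  by rewrite eq C' in nC.
- move=> [x u] [x' u'] /half_inj eq.
  have eqm := congr1 fst eq; have equ := congr1 (oppd \o snd) eq.
  rewrite /= !oppK in equ; rewrite /= equ in eqm.
  by rewrite equ -[x](moveK x u') eqm moveK.
- by move=> [x u] [x' u'] /half_inj.
Qed.

Definition plane_rel (c : config d.+2) : rel z2 := fun z z' =>
  [exists u : pdir, (z' == move z u) &&
    ((emb_dir u \in c (emb z)) || (emb_dir (oppd u) \in c (emb z')))].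

Lemma plane_rel_edge c z z' : plane_rel c z z' -> edge c (emb z) (emb z').
Proof.
case/existsP => u /andP[/eqP-> h]; apply/existsP; exists (emb_dir u).
by rewrite emb_move eqxx -emb_opp -emb_move.
Qed.

Lemma plane_rel_move c z z' : plane_rel c z z' ->
  z' \in [seq move z u | u <- enum (pdir : finType)].
Proof. by case/existsP => u /andP[/eqP-> _]; apply: map_f; rewrite mem_enum. Qed.

Lemma closed_walk_of_not_percolates c : ~ percolates c ->
  exists j (t : j.+1.-tuple 'I_3), let H := halves (walk (start j) t) in
    uniq H && all (fun h => h.2 \notin c h.1) H.
Proof.
move=> nperc; have noray : ~ ray (plane_rel c) (0, 0).
  case=> f [f0 fi fe]; apply: nperc; exists (emb \o f); split.
  - by rewrite /= f0 emb0.
  - exact: inj_comp emb_inj fi.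
  - by move=> n; apply/edgeP/plane_rel_edge.
have [s sP] := finite_reach (@plane_rel_move c) noray.
pose C : pred z2 := fun z =>
  `[< exists2 p, path (plane_rel c) (0, 0) p & last (0, 0) p = z >].
have C0 : C (0, 0) by apply/asboolP; exists [::].
have Cstep z z' : C z -> plane_rel c z z' -> C z'.
  move=> /asboolP[p pp lp] zz'; apply/asboolP; exists (rcons p z').
    by rewrite rcons_path pp lp.
  by rewrite last_rcons.
have Cs : {subset C <= s} by move=> z /asboolP[p pp <-]; apply: sP.
have Cconn : potential_connected C.
  move=> g gstep _ /asboolP[p pp <-].
  elim/last_ind: p pp => [//|p z IH]; rewrite rcons_path last_rcons.
  move=> /andP[pp zz]; rewrite -IH //.
  have Cl : C (last (0, 0) p) by apply/asboolP; exists p.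
  have Cz := Cstep _ _ Cl zz.
  by case/existsP: zz Cz => u /andP[/eqP-> _]; apply: gstep.
have [j [t [ut bt]]] := closed_walk_exists Cs Cconn C0.
exists j, t; rewrite /= (uniq_halves ut bt) /=.
(* If either endpoint of a boundary side chose the other, the outer endpoint would belong to the
   cluster. *)
have clos e : e \in walk (start j) t ->
    (emb_dir e.2 \notin c (emb e.1)) &&
    (emb_dir (oppd e.2) \notin c (emb (move e.1 e.2))).
  move=> /(allP bt)/andP[Ce nCe]; rewrite -negb_or; apply: contra nCe => h.
  by apply: Cstep Ce _; apply/existsP; exists e.2; rewrite eqxx.
rewrite all_cat !all_map; apply/andP.
by split; apply/allP => e /clos /andP[].
Qed.

End Plane.

(** * The Peierls sum *)

Section Positivity.
Context {R : realType} {dsp : measure_display} {T : measurableType dsp}.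
Variables (P : probability T R) (d : nat) (X : vtx d.+2 -> T -> {set dir d.+2}).
Hypothesis model : kneighbor_model P d.+2 X.

(** Turn sequences whose pairs repeat get the empty event, so that the bound 4^-(j+2) holds for
    every [t]. *)
Definition walk_closed j (t : j.+1.-tuple 'I_3) : set T :=
  let H := halves d (walk (start j) t) in if uniq H then unchosen X H else set0.

Lemma measurable_walk_closed j t : measurable (@walk_closed j t).
Proof.
by rewrite /walk_closed; case: ifP => _ //; apply: (measurable_unchosen model).
Qed.

Lemma walk_closed_prob_le j t :
  (P (@walk_closed j t) <= (4^-1 ^+ j.+2)%:E)%E.
Proof.
rewrite /walk_closed; case: ifP => [uH|_]; last first.
  by rewrite measure0 lee_fin exprn_ge0.
apply: le_trans (unchosen_prob_le model _ uH) _ => //.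
rewrite size_halves size_walk size_tuple mulnC exprM lee_fin.
by rewrite (_ : 2^-1 ^+ 2 = 4^-1) //; field.
Qed.

Definition some_walk_closed j : set T :=
  \bigcup_(t in [set` (predT : pred (j.+1.-tuple 'I_3))]) walk_closed t.

Lemma measurable_some_walk_closed j : measurable (some_walk_closed j).
Proof.
rewrite /some_walk_closed bigcup_pred.
by apply: bigsetU_measurable => t _; apply: measurable_walk_closed.
Qed.

Lemma some_walk_closed_prob_le j :
  (P (some_walk_closed j) <= (3 / 16 * (3 / 4) ^+ j)%:E)%E.
Proof.
rewrite /some_walk_closed bigcup_pred.
apply: le_trans (measure_bigsetU_le _ _ _ (@measurable_walk_closed j)) _.
apply: le_trans (lee_sum _ (fun t _ => walk_closed_prob_le t)) _.
rewrite sumEFin lee_fin sumr_const card_tuple card_ord.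
rewrite -[X in X <= _]mulr_natr natrX.
rewrite [(3 / 4) ^+ j]exprMn !exprS le_eqVlt; apply/orP; left; apply/eqP.
by field.
Qed.

Lemma not_perc_prob_le : (P (~` perc_event X) <= (3 / 4)%:E)%E.
Proof.
have mU : measurable (\bigcup_j some_walk_closed j).
  by apply: bigcupT_measurable => j; apply: measurable_some_walk_closed.
apply: (@le_trans _ _ (P (\bigcup_j some_walk_closed j))).
  apply: le_measure; rewrite ?inE //.
    by apply: measurableC; apply: measurable_perc model.
  move=> w /closed_walk_of_not_percolates[j [t /andP[uH cH]]].
  by exists j => //; exists t => //; rewrite /walk_closed uH.
apply: le_trans
  (generalized_Boole_inequality _ measurable_some_walk_closed mU) _.
apply: lime_le; first by apply: is_cvg_nneseries => n _ _.
apply: nearW => n.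
apply: le_trans (lee_sum _ (fun j _ => some_walk_closed_prob_le j)) _.
rewrite sumEFin lee_fin.
(* Partial geometric sum in closed form, visibly at most 3/4. *)
have -> : \sum_(0 <= j < n) 3 / 16 * (3 / 4) ^+ j =
    3 / 4 - 3 / 4 * (3 / 4) ^+ n :> R.
  elim: n => [|n IH]; first by rewrite big_geq // expr0 mulr1 subrr.
  rewrite big_nat_recr //= IH exprS; by field.
by rewrite gerBl mulr_ge0 // ?exprn_ge0.
Qed.

Lemma perc_prob_gt0 : (0 < P (perc_event X))%E.
Proof.
have mperc := measurable_perc model.
have := not_perc_prob_le; rewrite probability_setC //.
have := fin_num_measure P _ mperc; case: (P _) => // p _.
by rewrite -EFinB lee_fin lte_fin; lra.
Qed.

End Positivity.

Lemma thetaU_pos_balanced d : thetaU_pos d.+2 d.+2.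
Proof.
move=> R dsp T P X model.
by split; [exact: measurable_perc model | exact: perc_prob_gt0 model].
Qed.

Theorem theorem2p9 : thetaU_pos 2 2 /\ thetaU_pos 3 3.
Proof. by split; apply: thetaU_pos_balanced. Qed.
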